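(* Let $\alpha\in\mathbb{N}_0$, $\lambda\in\mathbb{R}$, $x\in\mathbb{R}$, and let $n\ge 2\alpha$ be an integer. Then $$a_{n-2\alpha}^{(\alpha)}(x;\lambda)=\frac{B_n^{(2\alpha)}(x;\lambda;1/2)}{2^{\alpha}\langle n\rangle_{2\alpha}},$$ where $a_m^{(\alpha)}(x;\lambda)$ are the degenerate Fubini-type polynomials and $B_n^{(2\alpha)}(x;\lambda;1/2)$ are the degenerate Apostol-Bernoulli polynomials of order $2\alpha$ with parameter $\gamma=1/2$.
   Context: All generating functions are power series expansions in $t$ near $t=0$; for $\lambda\neq0$, $(1+\lambda t)^{y/\lambda}$ is the principal power, and for $\lambda=0$ it is understood as its limit $e^{yt}$. The degenerate Fubini-type polynomials are defined by $$\frac{2^{\alpha}}{\left(2-(1+\lambda t)^{1/\lambda}\right)^{2\alpha}}(1+\lambda t)^{x/\lambda}=\sum_{n=0}^{\infty}a_n^{(\alpha)}(x;\lambda)\frac{t^n}{n!}.$$ The degenerate Apostol-Bernoulli polynomials of order $\beta$ are defined by $$\left(\frac{t}{\gamma(1+\lambda t)^{1/\lambda}-1}\right)^{\beta}(1+\lambda t)^{x/\lambda}=\sum_{n=0}^{\infty}B_n^{(\beta)}(x;\lambda;\gamma)\frac{t^n}{n!}.$$ $\langle y\rangle_m=y(y-1)\cdots(y-m+1)$ for $m\ge1$, $\langle y\rangle_0=1$, is the falling factorial. *)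

(* Defs.v *)
From Stdlib Require Import Reals Factorial Lra ClassicalEpsilon.
From Coquelicot Require Import Coquelicot.
Open Scope R_scope.

(* The neighbourhood of 0 is punctured because a generating function such as
   t / ((1 + lambda t)^(1/lambda) - 1) has a removable singularity at t = 0,
   where the total division of R returns a meaningless value. *)
Definition is_egf (f : R -> R) (c : nat -> R) : Prop :=
  locally' 0 (fun t => is_pseries (fun n => c n / INR (fact n)) t (f t)).

(* Chosen by epsilon: meaningful only when f has an expansion, which is then
   unique by [egf_coef_unique]. *)
Definition egf_coef (f : R -> R) : nat -> R :=
  epsilon (inhabits (fun _ => 0)) (is_egf f).

Lemma is_egf_cv (f : R -> R) (c : nat -> R) :
  is_egf f c -> Rbar_lt 0 (CV_radius (fun n => c n / INR (fact n))).
Proof.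
intros [e He].
assert (Hp := cond_pos e).
assert (Hex : ex_pseries (fun n => c n / INR (fact n)) (e / 2)).
{ exists (f (e / 2)); apply He; [|lra].
  change (Rabs (e / 2 - 0) < e); rewrite Rabs_pos_eq; lra. }
apply Rbar_lt_le_trans with (Finite (Rabs (e / 2))).
- simpl; rewrite Rabs_pos_eq; lra.
- destruct (Rbar_le_lt_dec (Rabs (e / 2))
     (CV_radius (fun n => c n / INR (fact n)))) as [H|H]; [exact H|].
  exfalso; apply (CV_disk_outside _ _ H).
  apply is_lim_seq_ext with
    (fun n => scal (pow_n (e / 2) n) (c n / INR (fact n))).
  + intros n; rewrite pow_n_pow; unfold scal; simpl; unfold mult; simpl; ring.
  + apply ex_series_lim_0; exact Hex.
Qed.

Lemma is_egf_unique (f : R -> R) (c d : nat -> R) :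
  is_egf f c -> is_egf f d -> forall n, c n = d n.
Proof.
intros Hc Hd n.
assert (Rc := is_egf_cv _ _ Hc); assert (Rd := is_egf_cv _ _ Hd).
assert (Hne : locally' 0 (fun t => PSeries (fun n => c n / INR (fact n)) t
                       = PSeries (fun n => d n / INR (fact n)) t)).
{ generalize (filter_and _ _ Hc Hd); apply filter_imp; intros t [H1 H2].
  rewrite (is_pseries_unique _ _ _ H1), (is_pseries_unique _ _ _ H2); easy. }
assert (H0 : PSeries (fun n => c n / INR (fact n)) 0
           = PSeries (fun n => d n / INR (fact n)) 0).
{ assert (Lc : is_lim (PSeries (fun n => c n / INR (fact n))) 0
                 (PSeries (fun n => c n / INR (fact n)) 0)).
  { apply is_lim_continuity, PSeries_continuity.
    rewrite Rabs_R0; exact Rc. }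
  assert (Ld : is_lim (PSeries (fun n => d n / INR (fact n))) 0
                 (PSeries (fun n => d n / INR (fact n)) 0)).
  { apply is_lim_continuity, PSeries_continuity.
    rewrite Rabs_R0; exact Rd. }
  apply is_lim_unique in Ld.
  apply (is_lim_ext_loc _ _ (Finite 0) _ Hne), is_lim_unique in Lc.
  rewrite Ld in Lc; injection Lc; easy. }
assert (E : c n / INR (fact n) = d n / INR (fact n)).
{ apply (PSeries_ext_recip (fun n => c n / INR (fact n))
           (fun n => d n / INR (fact n)) n Rc Rd).
  destruct Hne as [e He]; exists e; intros t Ht.
  destruct (Req_dec t 0) as [->|Hz]; [exact H0|apply He; assumption]. }
assert (F := INR_fact_neq_0 n).
apply Rmult_eq_reg_r with (/ INR (fact n)); [exact E|].
apply Rinv_neq_0_compat; exact F.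
Qed.

Lemma egf_coef_unique (f : R -> R) (c : nat -> R) :
  is_egf f c -> forall n, egf_coef f n = c n.
Proof.
intros Hc; apply (is_egf_unique f); [|exact Hc].
unfold egf_coef; apply epsilon_spec; exists c; exact Hc.
Qed.

(* (1 + lambda t)^(y / lambda), extended by its limit at lambda = 0.  [Rpower]
   is the principal power for a positive base, so for t near 0. *)
Definition degenerate_exp (lambda y t : R) : R :=
  if Req_EM_T lambda 0 then exp (y * t)
  else Rpower (1 + lambda * t) (y / lambda).

Definition degenerate_fubini (alpha : nat) (x lambda : R) : nat -> R :=
  egf_coef (fun t =>
    2 ^ alpha / (2 - degenerate_exp lambda 1 t) ^ (2 * alpha)
      * degenerate_exp lambda x t).

Definition degenerate_apostol_bernoulli (beta : nat) (x lambda gamma : R) :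
    nat -> R :=
  egf_coef (fun t =>
    (t / (gamma * degenerate_exp lambda 1 t - 1)) ^ beta
      * degenerate_exp lambda x t).

Fixpoint falling (y : R) (m : nat) : R :=
  match m with
  | O => 1
  | S k => falling y k * (y - INR k)
  end.

(* Main.v *)
(* With e(t) = (1 + lambda t)^(1/lambda), t / (e/2 - 1) = -2 t / (2 - e), so the
   Apostol-Bernoulli generating function is 2^alpha t^(2 alpha) times the Fubini
   one and the formula follows by comparing coefficients.  As the coefficients
   are chosen by epsilon, one must also show that the Fubini function has a
   power series expansion at 0: (1 + lambda t)^(x/lambda) does because it solves
   a linear equation, and products and reciprocals preserve expandability. *)
Require Import Defs.
From Stdlib Require Import Reals Factorial PeanoNat Lra Lia.
From Coquelicot Require Import Coquelicot.
Open Scope R_scope.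

(** * Convergent expansions at 0 and their radii *)

(** Unlike in [is_egf], the point 0 is included, so that [f 0] is the constant coefficient, and
    there are no factorials, so that products of functions correspond to [PS_mult]. *)
Definition has_expansion (f : R -> R) (a : nat -> R) : Prop :=
  locally 0 (fun t => is_pseries a t (f t)).

Lemma is_egf_of_expansion (f : R -> R) (a : nat -> R) :
  has_expansion f a -> is_egf f (fun n => a n * INR (fact n)).
Proof.
intros [e He]; exists e; intros t Ht _.
apply is_pseries_ext with a; [|apply He, Ht].
intros n; change (a n = a n * INR (fact n) / INR (fact n)).
field; apply INR_fact_neq_0.
Qed.

Lemma expansion_radius_pos (f : R -> R) (a : nat -> R) :
  has_expansion f a -> Rbar_lt 0 (CV_radius a).
Proof.
intros Ha.
rewrite (CV_radius_ext a (fun n => a n * INR (fact n) / INR (fact n))).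
- apply (is_egf_cv f (fun n => a n * INR (fact n))), is_egf_of_expansion, Ha.
- intros n; field; apply INR_fact_neq_0.
Qed.

Lemma locally_0_radius (r : Rbar) :
  Rbar_lt 0 r -> locally 0 (fun t => Rbar_lt (Rabs t) r).
Proof.
intros Hr.
destruct (Rbar_lt_locally m_infty r 0 I Hr) as [d Hd].
exists d; intros t Ht.
assert (Hb : Rabs t < d) by (rewrite <- (Rminus_0_r t); exact Ht).
apply (Hd (Rabs t)).
change (Rabs (Rabs t - 0) < d); rewrite Rminus_0_r, Rabs_Rabsolu; exact Hb.
Qed.

(** The terms of a series that converges at a point [d / 2 > 0] tend to 0, hence are bounded;
    dividing by the powers of [d / 2] gives the bound. *)
Lemma geometric_bound (a : nat -> R) :
  Rbar_lt 0 (CV_radius a) ->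
  exists M K, 0 < M /\ 0 < K /\ forall n, Rabs (a n) <= M * K ^ n.
Proof.
intros H; destruct (locally_0_radius _ H) as [d Hd].
assert (Hp := cond_pos d).
assert (Hr : Rbar_lt (d / 2) (CV_radius a)).
{ assert (Hh : Rabs (d / 2) = d / 2) by (apply Rabs_pos_eq; lra).
  rewrite <- Hh; apply Hd.
  change (Rabs (d / 2 - 0) < d); rewrite Rminus_0_r; lra. }
assert (Hex : ex_pseries a (d / 2)).
{ apply CV_radius_inside; rewrite Rabs_pos_eq; [exact Hr|lra]. }
apply ex_series_lim_0 in Hex.
destruct (filterlim_bounded (K := R_AbsRing) (V := R_NormedModule) _
            (ex_intro _ 0 Hex)) as [M HM].
(* The maximum with 1 makes the constant strictly positive. *)
exists (Rmax M 1), (/ (d / 2)).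
split; [apply Rlt_le_trans with 1; [lra|apply Rmax_r]|].
assert (H2 : 0 < d / 2) by lra.
split; [apply Rinv_0_lt_compat, H2|intros n].
specialize (HM n); rewrite pow_n_pow in HM.
change (Rabs ((d / 2) ^ n * a n) <= M) in HM.
assert (P := pow_lt _ n H2).
rewrite Rabs_mult, (Rabs_pos_eq ((d / 2) ^ n)) in HM by lra.
rewrite pow_inv.
apply Rmult_le_reg_l with ((d / 2) ^ n); [exact P|].
apply Rle_trans with M; [exact HM|].
replace ((d / 2) ^ n * (Rmax M 1 * / (d / 2) ^ n)) with (Rmax M 1)
  by (field; lra).
apply Rmax_l.
Qed.

Lemma radius_of_geometric_bound (a : nat -> R) (M K : R) :
  0 < K -> (forall n, Rabs (a n) <= M * K ^ n) -> Rbar_le (/ K) (CV_radius a).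
Proof.
intros HK Ha; apply CV_radius_bounded; exists M; intros n.
assert (P := pow_lt _ n HK).
rewrite Rabs_mult, pow_inv.
rewrite (Rabs_pos_eq (/ K ^ n)) by (apply Rlt_le, Rinv_0_lt_compat, P).
apply Rmult_le_reg_r with (K ^ n); [exact P|].
rewrite Rmult_assoc, Rinv_l, Rmult_1_r by lra; apply Ha.
Qed.

(** * Products, constants and powers *)

Lemma expansion_mult (f g : R -> R) (a b : nat -> R) :
  has_expansion f a -> has_expansion g b ->
  has_expansion (fun t => f t * g t) (PS_mult a b).
Proof.
intros Ha Hb.
assert (Ra := locally_0_radius _ (expansion_radius_pos _ _ Ha)).
assert (Rb := locally_0_radius _ (expansion_radius_pos _ _ Hb)).
generalize (filter_and _ _ (filter_and _ _ Ha Hb) (filter_and _ _ Ra Rb)).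
unfold has_expansion; apply filter_imp; intros t [[H1 H2] [H3 H4]]; apply is_pseries_mult; easy.
Qed.

Lemma expansion_const (c : R) :
  has_expansion (fun _ => c) (fun n => match n with O => c | _ => 0 end).
Proof.
unfold has_expansion; apply filter_forall; intros t.
set (d := fun n => match n with O => c | _ => 0 end).
assert (Hr : CV_radius d = p_infty).
(* Differentiation preserves the radius and turns [d] into the zero series. *)
{ rewrite <- CV_radius_derive, <- CV_radius_const_0; apply CV_radius_ext.
  intros n; unfold PS_derive, d; ring. }
assert (Hex : ex_pseries d t) by (apply CV_radius_inside; rewrite Hr; exact I).
replace c with (PSeries d t); [apply PSeries_correct, Hex|].
rewrite PSeries_decr_1 by exact Hex.
change (PS_decr_1 d) with (fun _ : nat => 0); rewrite PSeries_const_0.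
simpl; ring.
Qed.

Lemma expansion_pow (f : R -> R) (a : nat -> R) (m : nat) :
  has_expansion f a -> exists b, has_expansion (fun t => f t ^ m) b.
Proof.
intros Ha; induction m as [|m [b IH]].
- eexists; apply (expansion_const 1).
- exists (PS_mult a b); apply (expansion_mult f (fun t => f t ^ m)); assumption.
Qed.

(** * Reciprocals of power series *)

(* [reciprocal_upto a n] agrees with the reciprocal series of [a] on the
   indices [0..n]; tabulating makes course-of-values recursion structural. *)
Fixpoint reciprocal_upto (a : nat -> R) (n : nat) : nat -> R :=
  match n with
  | O => fun _ => / a 0%nat
  | S m => fun k =>
      if Nat.leb k m then reciprocal_upto a m k
      else - / a 0%nat
           * sum_f_R0 (fun j => a (S j) * reciprocal_upto a m (m - j)%nat) m
  end.

Definition reciprocal (a : nat -> R) (n : nat) : R := reciprocal_upto a n n.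

Lemma reciprocal_upto_le (a : nat -> R) (n k : nat) :
  (k <= n)%nat -> reciprocal_upto a n k = reciprocal a k.
Proof.
induction n as [|n IH]; intros Hk.
- replace k with 0%nat by lia; reflexivity.
- destruct (Nat.eq_dec k (S n)) as [->|H]; [reflexivity|].
  simpl; replace (Nat.leb k n) with true by (symmetry; apply Nat.leb_le; lia).
  apply IH; lia.
Qed.

(** This is the vanishing of the coefficient of index [S n] in the Cauchy product of [a] with its
    reciprocal, solved for the newest term. *)
Lemma reciprocal_S (a : nat -> R) (n : nat) :
  reciprocal a (S n)
  = - / a 0%nat * sum_f_R0 (fun j => a (S j) * reciprocal a (n - j)%nat) n.
Proof.
unfold reciprocal at 1; cbn [reciprocal_upto].
replace (Nat.leb (S n) n) with false by (symmetry; apply Nat.leb_gt; lia).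
f_equal; apply sum_eq; intros j Hj; f_equal; apply reciprocal_upto_le; lia.
Qed.

Lemma PS_mult_reciprocal (a : nat -> R) (n : nat) :
  a 0%nat <> 0 ->
  PS_mult a (reciprocal a) n = match n with O => 1 | _ => 0 end.
Proof.
intros H0; unfold PS_mult; destruct n as [|n].
- simpl; unfold reciprocal; simpl; field; exact H0.
- rewrite decomp_sum by lia; simpl pred; rewrite Nat.sub_0_r, reciprocal_S.
  simpl; field; exact H0.
Qed.

(** Strong induction on the recurrence. The ratio [K * q] with [q = 1 + M / c] and [c = Rabs (a 0)]
    is chosen so that the geometric sum produced by the recurrence closes up: [M / c = q - 1]. *)
Lemma reciprocal_geometric_bound (a : nat -> R) (M K : R) :
  0 < M -> 0 < K -> (forall n, Rabs (a n) <= M * K ^ n) -> a 0%nat <> 0 ->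
  forall n, Rabs (reciprocal a n)
            <= / Rabs (a 0%nat) * (K * (1 + M / Rabs (a 0%nat))) ^ n.
Proof.
intros HM HK Ha H0.
assert (Hp := Rabs_pos_lt _ H0).
set (c := Rabs (a 0%nat)) in *.
set (q := 1 + M / c).
assert (Hq : 0 < M / c) by (apply Rdiv_lt_0_compat; assumption).
assert (Hic := Rinv_0_lt_compat _ Hp).
intros n; induction n as [n IH] using (well_founded_induction Nat.lt_wf_0).
destruct n as [|n].
- unfold reciprocal; simpl; rewrite Rabs_inv; fold c; lra.
- rewrite reciprocal_S, Rabs_mult, Rabs_Ropp, Rabs_inv; fold c.
  apply Rmult_le_compat_l; [lra|].
  apply Rle_trans with
    (sum_f_R0 (fun j => q ^ (n - j) * (M / c * K ^ S n)) n).
  + eapply Rle_trans; [apply Rsum_abs|].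
    apply sum_Rle; intros j Hj; rewrite Rabs_mult.
    apply Rle_trans with
      (M * K ^ S j * (/ c * (K * q) ^ (n - j))).
    * apply Rmult_le_compat; [apply Rabs_pos|apply Rabs_pos|apply Ha|].
      apply IH; lia.
    (* The powers of [K] combine to [K ^ S n] independently of [j]; only the power of [q] varies. *)
    * right; rewrite Rpow_mult_distr.
      replace (S n) with (S j + (n - j))%nat by lia.
      rewrite (pow_add K); unfold Rdiv; ring.
  + rewrite <- scal_sum.
    assert (E : M / c * sum_f_R0 (fun j => q ^ (n - j)) n = q ^ S n - 1).
    (* Reversing the order of summation gives the standard geometric sum. *)
    { assert (Hs : sum_f_R0 (fun j => q ^ (n - j)) n
                   = sum_f_R0 (fun j => q ^ j) n).
      { clear; induction n as [|n IH]; [reflexivity|].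
        rewrite decomp_sum by lia; simpl pred.
        rewrite (sum_eq _ (fun j => q ^ (n - j))), IH, tech5 by (intros; f_equal; lia).
        rewrite Nat.sub_0_r; ring. }
      rewrite Hs, tech3 by (unfold q; lra).
      unfold q; field; split; lra. }
    replace (M / c * K ^ S n * sum_f_R0 (fun j => q ^ (n - j)) n)
      with (K ^ S n * (q ^ S n - 1)) by (rewrite <- E; ring).
    rewrite Rpow_mult_distr; assert (P := pow_lt _ (S n) HK); nra.
Qed.

(** The formal reciprocal has positive radius by the geometric bound, so its sum times [f] has the
    expansion of the constant 1 and equals 1 near 0. *)
Lemma expansion_inv (f : R -> R) (a : nat -> R) :
  has_expansion f a -> f 0 <> 0 ->
  has_expansion (fun t => / f t) (reciprocal a).
Proof.
intros Ha Hf.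
assert (H0 : a 0%nat <> 0).
{ rewrite <- PSeries_0, (is_pseries_unique a 0 (f 0)); [exact Hf|].
  apply (locally_singleton _ _ Ha). }
destruct (geometric_bound a (expansion_radius_pos _ _ Ha))
  as (M & K & HM & HK & Hb).
assert (Hq : 0 < K * (1 + M / Rabs (a 0%nat))).
{ apply Rmult_lt_0_compat; [exact HK|].
  assert (0 < M / Rabs (a 0%nat)); [|lra].
  apply Rdiv_lt_0_compat; [exact HM|apply Rabs_pos_lt, H0]. }
assert (Rb : Rbar_lt 0 (CV_radius (reciprocal a))).
{ apply Rbar_lt_le_trans with (Finite (/ (K * (1 + M / Rabs (a 0%nat)))));
    [apply (Rinv_0_lt_compat _ Hq)
    |apply (radius_of_geometric_bound _ (/ Rabs (a 0%nat)) _ Hq)].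
  apply reciprocal_geometric_bound; assumption. }
assert (Hr : has_expansion (PSeries (reciprocal a)) (reciprocal a)).
{ generalize (locally_0_radius _ Rb); unfold has_expansion; apply filter_imp; intros t Ht.
  apply PSeries_correct, CV_radius_inside, Ht. }
generalize (filter_and _ _ (filter_and _ _ Hr (expansion_mult _ _ _ _ Ha Hr))
                           (expansion_const 1)).
unfold has_expansion; apply filter_imp; intros t [[H1 H2] H3].
replace (/ f t) with (PSeries (reciprocal a) t); [exact H1|].
assert (E : f t * PSeries (reciprocal a) t = 1).
{ rewrite <- (is_pseries_unique _ _ _ H2), <- (is_pseries_unique _ _ _ H3).
  apply PSeries_ext; intros n; apply PS_mult_reciprocal, H0. }
(* That [f t] is nonzero follows from the product being 1. *)
apply Rmult_eq_reg_l with (f t); [rewrite E; symmetry; apply Rinv_r|];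
  intros Z; rewrite Z in E; lra.
Qed.

(** * Expansion of the degenerate exponential *)

Lemma degenerate_exp_0 (lambda y : R) : degenerate_exp lambda y 0 = 1.
Proof.
unfold degenerate_exp; destruct (Req_EM_T lambda 0) as [_|_].
- rewrite Rmult_0_r; apply exp_0.
- unfold Rpower; rewrite Rmult_0_r, Rplus_0_r, ln_1, Rmult_0_r; apply exp_0.
Qed.

(** True for every [t]: [Rpower] is the exponential of a multiple of [ln], whatever value [ln]
    takes. *)
Lemma degenerate_exp_opp (lambda y t : R) :
  degenerate_exp lambda y t * degenerate_exp lambda (- y) t = 1.
Proof.
unfold degenerate_exp; destruct (Req_EM_T lambda 0) as [_|_];
  unfold Rpower; rewrite <- exp_plus, <- exp_0; f_equal; unfold Rdiv; ring.
Qed.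

Lemma is_derive_degenerate_exp (lambda y t : R) :
  0 < 1 + lambda * t ->
  is_derive (degenerate_exp lambda y) t
            (y / (1 + lambda * t) * degenerate_exp lambda y t).
Proof.
intros Ht; unfold degenerate_exp.
destruct (Req_EM_T lambda 0) as [->|H]; unfold Rpower; auto_derive; auto.
- field; lra.
- field; lra.
Qed.

(** In closed form, y (y - lambda) ... (y - (n-1) lambda) / n!, which for lambda = 0 is y^n / n!. *)
Fixpoint degenerate_exp_coef (lambda y : R) (n : nat) : R :=
  match n with
  | O => 1
  | S m => degenerate_exp_coef lambda y m * (y - INR m * lambda) / INR (S m)
  end.

(** Each new factor satisfies |y - n lambda| / (n + 1) <= |y| + |lambda|; the extra 1 keeps the base
    positive. *)
Lemma degenerate_exp_coef_bound (lambda y : R) (n : nat) :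
  Rabs (degenerate_exp_coef lambda y n)
  <= 1 * (Rabs y + Rabs lambda + 1) ^ n.
Proof.
induction n as [|n IH]; [simpl; rewrite Rabs_R1; lra|].
change (degenerate_exp_coef lambda y (S n)) with
  (degenerate_exp_coef lambda y n * (y - INR n * lambda) / INR (S n)).
unfold Rdiv; rewrite Rmult_assoc, Rabs_mult.
replace (1 * (Rabs y + Rabs lambda + 1) ^ S n) with
  (1 * (Rabs y + Rabs lambda + 1) ^ n * (Rabs y + Rabs lambda + 1))
  by (simpl; ring).
apply Rmult_le_compat; try apply Rabs_pos; [exact IH|].
assert (Hn := pos_INR n); rewrite S_INR.
rewrite Rabs_mult, Rabs_inv, (Rabs_pos_eq (INR n + 1)) by lra.
apply Rmult_le_reg_r with (INR n + 1); [lra|].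
rewrite Rmult_assoc, Rinv_l, Rmult_1_r by lra.
assert (T := Rabs_triang y (- (INR n * lambda))).
rewrite Rabs_Ropp, Rabs_mult, (Rabs_pos_eq (INR n)) in T by lra.
assert (Py := Rabs_pos y); assert (Pl := Rabs_pos lambda).
unfold Rminus; nra.
Qed.

(* The series solves (1 + lambda t) u' = y u, as does [degenerate_exp], so the
   quotient of the two is constant. *)
Lemma expansion_degenerate_exp (lambda y : R) :
  has_expansion (degenerate_exp lambda y) (degenerate_exp_coef lambda y).
Proof.
set (a := degenerate_exp_coef lambda y).
set (K := Rabs y + Rabs lambda + 1).
assert (Py := Rabs_pos y); assert (Pl := Rabs_pos lambda).
assert (HK : 0 < K) by (unfold K; lra).
assert (Hin : forall t, Rabs t < / K -> Rbar_lt (Rabs t) (CV_radius a)).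
{ intros t Ht.
  apply Rbar_lt_le_trans with (Finite (/ K)); [exact Ht|].
  apply (radius_of_geometric_bound a 1 K HK), degenerate_exp_coef_bound. }
(* Since [K] exceeds [Rabs lambda], the disk of radius [/ K] also keeps the base of the power
   positive. *)
assert (Hpos : forall t, Rabs t < / K -> 0 < 1 + lambda * t).
{ intros t Ht.
  assert (Rabs (lambda * t) < 1).
  { rewrite Rabs_mult.
    assert (K * Rabs t < 1).
    { rewrite <- (Rinv_r K) by lra; apply Rmult_lt_compat_l; assumption. }
    assert (Pt := Rabs_pos t); unfold K in *; nra. }
  assert (B := Rabs_def2 _ _ H); lra. }
assert (Hode : forall t, Rabs t < / K ->
          (1 + lambda * t) * PSeries (PS_derive a) t = y * PSeries a t).
{ intros t Ht.
  assert (Hex := CV_radius_inside _ _ (Hin t Ht)).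
  assert (Hed := ex_pseries_derive _ _ (Hin t Ht)).
  replace ((1 + lambda * t) * PSeries (PS_derive a) t) with
    (PSeries (PS_derive a) t + lambda * (t * PSeries (PS_derive a) t)) by ring.
  rewrite <- PSeries_incr_1, <- !PSeries_scal, <- PSeries_plus;
    [|exact Hed|apply ex_pseries_scal; [apply Rmult_comm|];
      apply ex_pseries_incr_1, Hed].
  (* Coefficientwise the equation reads (n+1) a_(n+1) + lambda n a_n = y a_n, the defining
     recurrence. Index 0 is separate because the shifted series starts with 0. *)
  apply PSeries_ext; intros n.
  unfold PS_plus, PS_scal, plus, scal; simpl; unfold mult; simpl.
  unfold PS_derive at 1; unfold a at 1.
  change (degenerate_exp_coef lambda y (S n)) with
    (a n * (y - INR n * lambda) / INR (S n)).
  assert (Hn : INR (S n) <> 0) by (apply not_0_INR; lia).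
  destruct n as [|n].
  - simpl; unfold zero; simpl; field.
  - simpl PS_incr_1; unfold PS_derive; field; exact Hn. }
exists (mkposreal _ (Rinv_0_lt_compat _ HK)); intros t Ht.
assert (Hb : Rabs t < / K) by (rewrite <- (Rminus_0_r t); exact Ht).
(* Multiplying by the exponential of [- y] stands for division by that of [y]. *)
set (h := fun u => PSeries a u * degenerate_exp lambda (- y) u).
assert (Hd : forall u, Rabs u < / K -> is_derive h u 0).
{ intros u Hu; assert (P := Hpos u Hu).
  evar_last.
  - apply (is_derive_mult (PSeries a) (degenerate_exp lambda (- y))).
    + apply is_derive_PSeries, Hin, Hu.
    + apply is_derive_degenerate_exp, P.
    + apply Rmult_comm.
  - unfold plus, mult; simpl.
    replace (PSeries (PS_derive a) u)
      with (y * PSeries a u / (1 + lambda * u)); [field; lra|].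
    rewrite <- (Hode u Hu); field; lra. }
assert (E : h t = h 0).
(* Mean value inequality with derivative bound 0. *)
{ assert (B : Rabs (h t - h 0) <= 0 * Rabs (t - 0)).
  { apply (bounded_variation h (fun _ => 0)); intros u Hu.
    rewrite !Rminus_0_r in Hu.
    split; [apply Hd; lra|rewrite Rabs_R0; apply Rle_refl]. }
  rewrite Rmult_0_l in B.
  destruct (Req_dec (h t - h 0) 0) as [Z|Z]; [lra|].
  apply Rabs_pos_lt in Z; lra. }
replace (degenerate_exp lambda y t) with (PSeries a t).
- apply PSeries_correct, CV_radius_inside, Hin, Hb.
- unfold h in E; rewrite degenerate_exp_0, PSeries_0 in E; change (a 0%nat) with 1 in E.
  assert (D := degenerate_exp_opp lambda y t).
  apply Rmult_eq_reg_r with (degenerate_exp lambda (- y) t); [lra|].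
  intros Z; rewrite Z in D; lra.
Qed.

(** * Comparison of the two generating functions *)

Lemma falling_fact (n m : nat) :
  (m <= n)%nat -> falling (INR n) m * INR (fact (n - m)) = INR (fact n).
Proof.
induction m as [|m IH]; intros Hm.
- simpl; rewrite Nat.sub_0_r; ring.
- rewrite <- IH by lia; simpl falling.
  replace (n - m)%nat with (S (n - S m)) by lia.
  rewrite fact_simpl, mult_INR, Rmult_assoc; f_equal; f_equal.
  rewrite <- minus_INR by lia; f_equal; lia.
Qed.

(* Also holds where [2 - e] vanishes, thanks to [/ 0 = 0]. *)
Lemma apostol_bernoulli_fubini_generating (alpha : nat) (e g t : R) :
  (t / (1 / 2 * e - 1)) ^ (2 * alpha) * g
  = t ^ (2 * alpha) * (2 ^ alpha * (2 ^ alpha / (2 - e) ^ (2 * alpha) * g)).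
Proof.
replace (t / (1 / 2 * e - 1)) with (- 2 * (t * / (2 - e))).
- rewrite !Rpow_mult_distr, pow_inv, (pow_mult (- 2)).
  replace ((- 2) ^ 2) with (2 * 2) by ring.
  rewrite Rpow_mult_distr; unfold Rdiv; ring.
- replace (1 / 2 * e - 1) with (- / 2 * (2 - e)) by field.
  unfold Rdiv; rewrite Rinv_mult, Rinv_opp, Rinv_inv; ring.
Qed.

Theorem theorem3p4 (alpha : nat) (lambda x : R) (n : nat)
  (hn : (2 * alpha <= n)%nat) :
  degenerate_fubini alpha x lambda (n - 2 * alpha)%nat =
  degenerate_apostol_bernoulli (2 * alpha) x lambda (1 / 2) n
    / (2 ^ alpha * falling (INR n) (2 * alpha)).
Proof.
set (m := (2 * alpha)%nat) in *.
set (F := fun t => 2 ^ alpha / (2 - degenerate_exp lambda 1 t) ^ m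
                   * degenerate_exp lambda x t).
assert (HF : exists c, has_expansion F c).
{ assert (Hden : has_expansion (fun t => 2 - degenerate_exp lambda 1 t)
                   (PS_minus (fun n => match n with O => 2 | _ => 0 end)
                             (degenerate_exp_coef lambda 1))).
  { generalize (filter_and _ _ (expansion_const 2)
                           (expansion_degenerate_exp lambda 1)).
    unfold has_expansion; apply filter_imp; intros t [H1 H2]; apply (is_pseries_minus _ _ _ _ _ H1 H2). }
  destruct (expansion_pow _ _ m Hden) as [b Hb].
  eexists; unfold F, Rdiv; apply expansion_mult;
    [|apply expansion_degenerate_exp].
  apply expansion_mult; [apply expansion_const|apply (expansion_inv _ _ Hb)].
  (* At 0 the denominator is a power of 2 - 1. *)
  rewrite degenerate_exp_0; apply pow_nonzero; lra. }
destruct HF as [c Hc].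
(* Multiplication by [t ^ m] shifts the Fubini coefficients by [m] places; the identity of
   generating functions holds at [t = 0] too. *)
assert (HG : has_expansion
  (fun t => (t / (1 / 2 * degenerate_exp lambda 1 t - 1)) ^ m
            * degenerate_exp lambda x t)
  (PS_incr_n (PS_scal (2 ^ alpha) c) m)).
{ revert Hc; unfold has_expansion; apply filter_imp; intros t Ht.
  unfold m; rewrite apostol_bernoulli_fubini_generating.
  rewrite <- (pow_n_pow t).
  exact (is_pseries_incr_n _ _ _ _
           (is_pseries_scal (2 ^ alpha) c t (F t) (Rmult_comm _ _) Ht)). }
unfold degenerate_fubini, degenerate_apostol_bernoulli.
rewrite (egf_coef_unique _ _ (is_egf_of_expansion _ _ Hc)).
rewrite (egf_coef_unique _ _ (is_egf_of_expansion _ _ HG)).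
rewrite PS_incr_n_simplify.
destruct (Compare_dec.le_lt_dec m n) as [_|H]; [|lia].
(* Passing from index [n - m] to [n] exchanges (n-m)! for n!; their ratio is the falling factorial
   of the formula. *)
rewrite <- (falling_fact n m hn).
assert (Hf : falling (INR n) m <> 0).
{ intros Z; apply (INR_fact_neq_0 n).
  rewrite <- (falling_fact n m hn), Z; ring. }
unfold PS_scal, scal; simpl; unfold mult; simpl; field.
split; [exact Hf|apply pow_nonzero; lra].
Qed.
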